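(* Let $q$ be a prime power, let $t$ be a positive integer and let $\epsilon>0$. Then, for all sufficiently large $n$, there exists a nonempty $t$-design $Y$ in $\mathrm{GL}(n,q)$ satisfying $|Y|/|\mathrm{GL}(n,q)|<\epsilon$.
   Context: A $t$-design in $\mathrm{GL}(n,q)$ (with $t\le n$) is a subset $Y$ of $\mathrm{GL}(n,q)$ that is transitive on the set of $t$-tuples of linearly independent elements of $\mathbb{F}_q^n$, meaning: there is a constant $r$ such that for all linearly independent $t$-tuples $(v_1,\dots,v_t)$ and $(v_1',\dots,v_t')$ of vectors in $\mathbb{F}_q^n$ there are exactly $r$ elements $g\in Y$ with $gv_i=v_i'$ for all $i$. *)

(* Defs.v *)
From HB Require Import structures.
From mathcomp Require Import all_boot all_order all_fingroup all_algebra.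
From mathcomp Require Import reals.

Set Implicit Arguments.
Unset Strict Implicit.
Unset Printing Implicit Defensive.

Import GRing.Theory Num.Theory.

Local Open Scope ring_scope.

(* Elements of {'GL_n[F]} are invertible matrices of size n.-1.+1, which is n
   as soon as 0 < n; group elements act on column vectors from the left. *)
Definition design (F : finFieldType) (t n : nat) (Y : {set {'GL_n[F]}}) : Prop :=
  (t <= n)%N /\
  exists r : nat, forall v v' : t.-tuple 'cV[F]_(n.-1.+1),
    free v -> free v' ->
    #|[set g in Y | [forall i : 'I_t, GLval g *m tnth v i == tnth v' i]]| = r.

(* Main.v *)
(** Let [P] select [t + 1] coordinates of the column space and let [Q 0], ...,
    [Q t] select disjoint groups of [s] further coordinates. Given [t] target
    vectors, some nonzero row [c *m P] vanishes on all of them. The shears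
    [1 + Q_i^T x c P], with [x] ranging over the columns of height [s] and
    [c_i] nonzero, act by left multiplication on the matrices sending [v] to
    [v'], and leave [P *m g] unchanged. The invariant
    [sum_j Q_j g (P g)^+ e_j], where [^+] is a right inverse, is translated by
    [c_i x], hence equidistributed over the [q ^ s] columns on every such set of
    matrices. So its zero set is a design of density [q ^ - s]. *)

Require Import Defs.
From HB Require Import structures.
From mathcomp Require Import all_boot all_order all_fingroup all_algebra.
From mathcomp Require Import reals.

Set Implicit Arguments.
Unset Strict Implicit.
Unset Printing Implicit Defensive.

Import Order.TTheory GRing.Theory Num.Theory.

Local Open Scope ring_scope.

(** The map [k (b - a)] injects the fiber of [f] over [a] into the fiber over [b], so all [#|A|]
    fibers have equal size. *)
Lemma card_equivariant_fiber (T : finType) (A : finZmodType) (G : {set T})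
    (f : T -> A) (k : A -> T -> T) :
  (forall x, injective (k x)) ->
  (forall x g, g \in G -> k x g \in G) ->
  (forall x g, g \in G -> f (k x g) = f g + x) ->
  #|G| = (#|A| * #|[set g in G | f g == 0%R]|)%N.
Proof.
move=> k_inj kG fk.
have fiber_le a b : (#|[set g in G | f g == a]| <= #|[set g in G | f g == b]|)%N.
  rewrite -(card_imset _ (k_inj (b - a))); apply/subset_leq_card/subsetP => h.
  case/imsetP=> g; rewrite !inE => /andP[Gg /eqP fg] ->.
  by rewrite kG // fk // fg addrC subrK eqxx.
rewrite -sum1_card (partition_big f predT) //= -sum_nat_const.
apply: eq_bigr => a _; rewrite -[RHS](_ : #|[set g in G | f g == a]| = _).
  by rewrite -sum1_card; apply: eq_bigl => g; rewrite inE.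
by apply/eqP; rewrite eqn_leq !fiber_le.
Qed.

Section Transporter.

Variables (F : finFieldType) (n : nat).
Implicit Types (g : {'GL_n[F]}) (Y : {set {'GL_n[F]}}).

Lemma GL_of_unitmx (A : 'M[F]_n.-1.+1) :
  A \in unitmx -> {g : {'GL_n[F]} | GLval g = A}.
Proof. by move=> Au; exists (FinRing.unit 'M[F]_n.-1.+1 Au). Qed.

Definition transporter t (V V' : 'M[F]_(n.-1.+1, t)) : {set {'GL_n[F]}} :=
  [set g | GLval g *m V == V'].

Lemma GL_transitive t (V V' : 'M[F]_(n.-1.+1, t)) :
  row_free V^T -> row_free V'^T -> exists g, GLval g *m V = V'.
Proof.
move=> Vfree V'free.
(* In row form, the matrix [pinvmx V^T *m V'^T] sends [V^T] to [V'^T] without loss of rank, so some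
   invertible matrix agrees with it on [V^T]. *)
have [|A Au VA] := @complete_unitmx _ _ _ V^T (pinvmx V^T *m V'^T).
  by rewrite mulmxA mulmxVp // mul1mx (eqP Vfree) (eqP V'free).
have [|g gE] := @GL_of_unitmx A^T; first by rewrite unitmx_tr.
exists g; rewrite gE; apply: trmx_inj.
by rewrite trmx_mul trmxK -VA mulmxA mulmxVp // mul1mx.
Qed.

Lemma card_transporter t (V V' W W' : 'M[F]_(n.-1.+1, t)) :
    row_free V^T -> row_free V'^T -> row_free W^T -> row_free W'^T ->
  #|transporter V V'| = #|transporter W W'|.
Proof.
have le (A A' B B' : 'M[F]_(n.-1.+1, t)) :
    row_free A^T -> row_free A'^T -> row_free B^T -> row_free B'^T ->
    (#|transporter A A'| <= #|transporter B B'|)%N.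
  move=> fA fA' fB fB'.
  have [a aE] := GL_transitive fB fA; have [b bE] := GL_transitive fA' fB'.
  (* With [a] sending [B] to [A] and [b] sending [A'] to [B'], this map carries one transporter into
     the other. *)
  have ba_inj : injective (fun g => b * g * a)%g by move=> g h /mulIg/mulgI.
  rewrite -(card_imset _ ba_inj).
  apply/subset_leq_card/subsetP => h /imsetP[g]; rewrite !inE => /eqP gE ->.
  by rewrite !GL_MxE -!mulmxA aE gE bE.
by move=> *; apply/eqP; rewrite eqn_leq !le.
Qed.

Definition cols_mx t (v : t.-tuple 'cV[F]_n.-1.+1) : 'M[F]_(n.-1.+1, t) :=
  \matrix_(i, j) tnth v j i 0.

Lemma cols_mx_free t (v : t.-tuple 'cV[F]_n.-1.+1) :
  free v -> row_free (cols_mx v)^T.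
Proof.
move/freeP=> v_free; apply: inj_row_free => u uv0.
apply/rowP=> j; rewrite mxE; apply: (v_free (u 0)) => {j}.
apply/colP=> i; rewrite summxE [RHS]mxE.
transitivity ((u *m (cols_mx v)^T) 0 i); last by rewrite uv0 mxE.
by rewrite [RHS]mxE; apply: eq_bigr => j _; rewrite !mxE (tnth_nth 0).
Qed.

Lemma tuple_transporter t (v v' : t.-tuple 'cV[F]_n.-1.+1) Y :
  [set g in Y | [forall i, GLval g *m tnth v i == tnth v' i]]
    = Y :&: transporter (cols_mx v) (cols_mx v').
Proof.
have tnthE (w : t.-tuple 'cV[F]_n.-1.+1) j : tnth w j = cols_mx w *m delta_mx j 0.
  by rewrite -colE; apply/colP=> i; rewrite !mxE.
apply/setP=> g; rewrite !inE; congr (_ && _).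
apply/forallP/eqP => [gv | gv j]; last by rewrite !tnthE mulmxA gv.
apply/matrixP=> i j; have /eqP/colP/(_ i) := gv j.
by rewrite !tnthE mulmxA -!colE !mxE.
Qed.

Section ShearCoord.

Variables (t s : nat).
Variables (P : 'M[F]_(t.+1, n.-1.+1)) (Q : 'I_t.+1 -> 'M[F]_(s, n.-1.+1)).
Hypotheses (PP : P *m P^T = 1%:M) (PQ : forall i, P *m (Q i)^T = 0).
Hypothesis QQ : forall i j, Q i *m (Q j)^T = (i == j)%:R%:M.

Definition shear_coord g : 'cV[F]_s :=
  \sum_i Q i *m GLval g *m pinvmx (P *m GLval g) *m delta_mx i 0.

(** The right inverse of [P *m g] is unchanged because [P *m h = P]. Only the summand of index [i]
    moves, by [x c (P g) (P g)^+ e_i = c_i x]. *)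
Lemma shear_coordM g h (x : 'cV[F]_s) (c : 'rV[F]_t.+1) i :
    GLval h = 1%:M + (Q i)^T *m x *m (c *m P) ->
  shear_coord (h * g)%g = shear_coord g + c 0 i *: x.
Proof.
move=> hE; have Ph : P *m GLval h = P.
  by rewrite hE mulmxDr mulmx1 !mulmxA PQ !mul0mx addr0.
have Qh j : Q j *m GLval h = Q j + (j == i)%:R *: (x *m c *m P).
  by rewrite hE mulmxDr mulmx1 !mulmxA QQ mul_scalar_mx -!scalemxAl.
have Pg_free : row_free (P *m GLval g).
  rewrite /row_free mxrankMfree ?row_free_unit ?GL_unitmx //.
  by apply/row_freeP; exists P^T.
rewrite /shear_coord GL_MxE mulmxA Ph.
under eq_bigr => j _ do rewrite (mulmxA (Q j)) Qh !mulmxDl.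
rewrite big_split /=; congr (_ + _).
rewrite (bigD1 i) //= eqxx scale1r big1 => [|j /negPf->]; last first.
  by rewrite scale0r !mul0mx.
rewrite addr0 -(mulmxA (x *m c)) -(mulmxA (x *m c)) mulmxVp // mulmx1 -mulmxA.
by rewrite -colE [col _ _]mx11_scalar mul_mx_scalar mxE.
Qed.

Lemma card_transporter_shear_coord (V V' : 'M[F]_(n.-1.+1, t)) :
  #|transporter V V'|
    = (#|F| ^ s * #|[set g in transporter V V' | shear_coord g == 0%R]|)%N.
Proof.
have [c [i ci cPV]] :
    exists c : 'rV[F]_t.+1, exists2 i, c 0 i = 1 & c *m (P *m V') = 0.
  (* [P *m V'] has [t + 1] rows but only [t] columns. The index [i] found here depends on [V'],
     which is why [shear_coord] sums over all indices; scaling to [c 0 i = 1] makes the translation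
     exactly [x]. *)
  have : kermx (P *m V') != 0.
    by rewrite kermx_eq0 /row_free neq_ltn ltnS rank_leq_col.
  case/rowV0Pn=> c /sub_kermxP cPV /rV0Pn[i ci].
  exists ((c 0 i)^-1 *: c); exists i; first by rewrite mxE mulVf.
  by rewrite -scalemxAl cPV scaler0.
have cPQ : c *m P *m (Q i)^T = 0 by rewrite -mulmxA PQ mulmx0.
(* The perturbation term squares to zero, so its negative gives the inverse. *)
have shear_unit x : 1%:M + (Q i)^T *m x *m (c *m P) \in unitmx.
  have /mulmx1_unit[//] : (1%:M + (Q i)^T *m x *m (c *m P))
      *m (1%:M - (Q i)^T *m x *m (c *m P)) = 1%:M.
  rewrite mulmxBr mulmx1 mulmxDl mul1mx opprD addrA addrK.
  set S := (Q i)^T *m x *m (c *m P).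
  have -> : S *m S = 0.
    by rewrite /S -mulmxA (mulmxA (c *m P)) (mulmxA (c *m P)) cPQ !mul0mx mulmx0.
  by rewrite subr0.
pose h x := sval (GL_of_unitmx (shear_unit x)).
have hE x : GLval (h x) = _ := svalP (GL_of_unitmx (shear_unit x)).
rewrite (@card_equivariant_fiber _ 'cV[F]_s _ shear_coord (fun x g => h x * g)%g).
- by rewrite card_mx muln1.
- by move=> x; apply: mulgI.
(* The shear fixes [V'] because [c *m P] annihilates it. *)
- move=> x g; rewrite !inE GL_MxE -mulmxA => /eqP ->.
  by rewrite hE mulmxDl mul1mx -!mulmxA cPV !mulmx0 addr0.
- by move=> x g _; rewrite (shear_coordM _ (hE x)) ci scale1r.
Qed.

Lemma card_shear_coord_eq0 :
  #|'GL_n[F]%g| = (#|F| ^ s * #|[set g | shear_coord g == 0%R]|)%N.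
Proof.
(* The whole group is itself a transporter, so the count above applies to it. *)
have GE : transporter (0 : 'M[F]_(n.-1.+1, t)) 0 = setT.
  by apply/setP=> g; rewrite !inE mulmx0 eqxx.
have := card_transporter_shear_coord 0 0; rewrite GE => ->.
by congr (_ * _)%N; apply: eq_card => g; rewrite !inE.
Qed.

Lemma design_shear_coord_eq0 : (t <= n)%N -> design t [set g : {'GL_n[F]} | shear_coord g == 0].
Proof.
move=> le_tn; split=> //.
have cardE (v v' : t.-tuple 'cV[F]_n.-1.+1) :
    #|[set g in [set g | shear_coord g == 0] |
        [forall i, GLval g *m tnth v i == tnth v' i]]|
    = (#|transporter (cols_mx v) (cols_mx v')| %/ #|F| ^ s)%N.
  rewrite tuple_transporter card_transporter_shear_coord mulKn; last first.
    by rewrite expn_gt0 (cardD1 0) inE.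
  by apply: eq_card => g; rewrite !inE andbC.
(* The constant is read off one free tuple; without any, the condition is vacuous. *)
case: (pickP (fun v : t.-tuple 'cV[F]_n.-1.+1 => free v)) => [w w_free | no_free].
  exists (#|transporter (cols_mx w) (cols_mx w)| %/ #|F| ^ s)%N => v v' fv fv'.
  by rewrite cardE; congr (_ %/ _)%N; apply: card_transporter; apply: cols_mx_free.
by exists 0%N => v v' fv; rewrite no_free in fv.
Qed.

End ShearCoord.

End Transporter.

Lemma rowsub1_mul_tr (R : nzRingType) (a b N : nat)
    (p : 'I_a -> 'I_N) (q : 'I_b -> 'I_N) :
  rowsub p (1%:M : 'M[R]_N) *m (rowsub q 1%:M)^T
    = \matrix_(i, j) (p i == q j)%:R.
Proof. by apply/matrixP=> i j; rewrite mul_rowsub_mx mul1mx !mxE eq_sym. Qed.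

Theorem theorem6p5 (R : realType) (F : finFieldType) (t : nat) (eps : R)
    (ht : (0 < t)%N) (heps : 0 < eps) :
  exists n0 : nat, forall n : nat, (n0 <= n)%N ->
    exists Y : {set {'GL_n[F]}},
      [/\ Y != set0, design t Y
        & #|Y|%:R / #|'GL_n[F]|%g%:R < eps].
Proof.
have [s s_big] : exists s : nat, eps^-1 < s%:R.
  by exists (Num.bound eps^-1); rewrite archi_boundP ?invr_ge0 ?ltW.
(* Labels [(None, i)] index the rows of [P] and [(Some a, i)] those of [Q i]; distinct labels select
   distinct coordinates, whence the orthogonality relations. *)
pose I := (option 'I_s * 'I_t.+1)%type.
exists #|{: I}| => n le_n.
have le_N : (#|{: I}| <= n.-1.+1)%N by apply: leq_trans le_n (leqSpred n).
pose idx (u : I) : 'I_n.-1.+1 := widen_ord le_N (enum_rank u).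
have idxE u v : (idx u == idx v) = (u == v).
  by rewrite -(inj_eq (@enum_rank_inj I)) -val_eqE.
pose P := rowsub (fun i => idx (None, i)) (1%:M : 'M[F]_n.-1.+1).
pose Q i := rowsub (fun a => idx (Some a, i)) (1%:M : 'M[F]_n.-1.+1).
have PP : P *m P^T = 1%:M.
  by rewrite rowsub1_mul_tr; apply/matrixP=> i j; rewrite !mxE idxE.
have PQ i : P *m (Q i)^T = 0.
  by rewrite rowsub1_mul_tr; apply/matrixP=> j a; rewrite !mxE idxE.
have QQ i j : Q i *m (Q j)^T = (i == j)%:R%:M.
  rewrite rowsub1_mul_tr; apply/matrixP=> a b; rewrite !mxE idxE xpair_eqE.
  by rewrite -mulrnA mulnb andbC.
have le_tn : (t <= n)%N.
  apply: leq_trans le_n; rewrite card_prod card_option !card_ord.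
  by rewrite mulSn addSn leqW ?leq_addr.
have cardG := card_shear_coord_eq0 PP PQ QQ.
have F_gt1 : (1 < #|F|)%N := card_finNzRing_gt1 F.
have G_gt0 : (0 < #|'GL_n[F]%g|)%N := cardG_gt0 _.
exists [set g | shear_coord P Q g == 0]; split.
- by rewrite -card_gt0; move: G_gt0; rewrite cardG muln_gt0 => /andP[].
- exact: design_shear_coord_eq0.
(* The density is exactly [q ^ - s], and [q ^ s > s > 1 / eps]. *)
have q_big : eps^-1 < (#|F| ^ s)%:R.
  by apply: lt_trans s_big _; rewrite ltr_nat ltn_expl.
rewrite ltr_pdivrMr ?ltr0n // cardG natrM mulrA ltr_pMl.
  by rewrite -ltr_pdivrMl // mulr1.
by rewrite ltr0n; move: G_gt0; rewrite cardG muln_gt0 => /andP[].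
Qed.
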